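(* Let $T\in\mathbb{R}^{n\times n}$ denote the $(1,1)$ block of $\mathcal{K}^{-1}$. Then the inverse of $\mathcal{K}=\begin{pmatrix} A-k^2M & B^T\\ B & 0\end{pmatrix}$ is given by $$\mathcal{K}^{-1}=\begin{pmatrix} T & CL^{-1}\\ L^{-1}C^T & k^2L^{-1}\end{pmatrix},$$ where $T$ satisfies $$(A-k^2M)T=AV,\qquad BT=0 .$$
   Context: Let $m\le n$ and let $k$ be a real number. $A\in\mathbb{R}^{n\times n}$ is symmetric positive semidefinite with $\dim\ker(A)=m$; $M\in\mathbb{R}^{n\times n}$ is symmetric positive definite; $B\in\mathbb{R}^{m\times n}$ has full row rank; $C\in\mathbb{R}^{n\times m}$ is a matrix whose columns form a basis of $\ker(A)$ (so $AC=0$) and satisfies $MC=B^T$; and $L=BC\in\mathbb{R}^{m\times m}$ (so $L=C^TMC$ is symmetric positive definite). Then $\mathbb{R}^n=\ker(A)\oplus\ker(B)$. Standing assumption: both $\mathcal{K}=\begin{pmatrix} A-k^2M & B^T\\ B & 0\end{pmatrix}$ and $A-k^2M$ are nonsingular. The matrix $V$ is $$V=(A+B^TL^{-1}B)^{-1}(I-B^TL^{-1}C^T)=(A+B^TL^{-1}B)^{-1}-CL^{-1}C^T,$$ which is the $(1,1)$ block of the inverse of $\mathcal{A}=\begin{pmatrix} A & B^T\\ B & 0\end{pmatrix}$, namely $\mathcal{A}^{-1}=\begin{pmatrix} V & CL^{-1}\\ L^{-1}C^T & 0\end{pmatrix}$. *)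

(* Defs.v *)
From HB Require Import structures.
From mathcomp Require Import all_boot all_order all_algebra.
From mathcomp Require Import reals.

Set Implicit Arguments.
Unset Strict Implicit.
Unset Printing Implicit Defensive.

Import Order.TTheory GRing.Theory Num.Theory.
Local Open Scope ring_scope.

Definition sym_posdef (R : realType) (n : nat) (M : 'M[R]_n) : Prop :=
  M \is symmetricmx /\
  forall x : 'cV[R]_n, x != 0 -> 0 < (x^T *m M *m x) 0 0.

Definition sym_possemidef (R : realType) (n : nat) (A : 'M[R]_n) : Prop :=
  A \is symmetricmx /\
  forall x : 'cV[R]_n, 0 <= (x^T *m A *m x) 0 0.

(* MathComp's [kermx] is the left kernel {u | u *m A = 0}.  The rows of
   [rkermx A] span the transposes of the column vectors x with A *m x = 0. *)
Definition rkermx (R : realType) (p n : nat) (A : 'M[R]_(p, n)) : 'M[R]_n :=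
  kermx A^T.

Definition cols_basis_ker (R : realType) (p n m : nat)
    (A : 'M[R]_(p, n)) (C : 'M[R]_(n, m)) : Prop :=
  row_free C^T /\ (C^T == rkermx A)%MS.

Definition saddle (R : realType) (n m : nat) (F : 'M[R]_n)
    (B : 'M[R]_(m, n)) : 'M[R]_(n + m) :=
  block_mx F B^T B 0.

Definition Vmx (R : realType) (n m : nat) (A : 'M[R]_n)
    (B : 'M[R]_(m, n)) (C : 'M[R]_(n, m)) : 'M[R]_n :=
  let L := B *m C in
  invmx (A + B^T *m invmx L *m B) *m (1%:M - B^T *m invmx L *m C^T).

(* Main.v *)
(* Since AC = 0 and MC = B^T, the column (C L^-1; k^2 L^-1) is mapped by K to
   (0; I), so it is the second block column of K^-1.  Multiplying the first
   row FT + B^T Y = I, with F = A - k^2 M, by C^T on the left and using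
   C^T F = - k^2 B and BT = 0 gives LY = C^T, hence FT = I - B^T L^-1 C^T =: P.
   With S = A + B^T L^-1 B one has C^T S = B, so B S^-1 = C^T, and C^T P = 0
   yields A V = A S^-1 P = P as well. *)
Require Import Defs.
From HB Require Import structures.
From mathcomp Require Import all_boot all_order all_algebra.
From mathcomp Require Import reals.

Set Implicit Arguments.
Unset Strict Implicit.
Unset Printing Implicit Defensive.

Import Order.TTheory GRing.Theory Num.Theory.
Local Open Scope ring_scope.

Lemma mulmx_col_inj_unitmx (F : fieldType) (n : nat) (N : 'M[F]_n) :
  (forall x : 'cV[F]_n, N *m x = 0 -> x = 0) -> N \in unitmx.
Proof.
move=> injN; rewrite -unitmx_tr -row_free_unit; apply: inj_row_free => v vN.
by apply: trmx_inj; rewrite trmx0; apply: injN; rewrite -[N]trmxK -trmx_mul vN trmx0.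
Qed.

(** [symmetricmx] is the Hermitian condition with sign exponent 0 and the identity as conjugation,
    so both the scalar and the entrywise map disappear. *)
Lemma symmetricmx_tr (R : fieldType) (n : nat) (N : 'M[R]_n) :
  N \is symmetricmx -> N^T = N.
Proof. by move=> /is_hermitianmxP; rewrite expr0 scale1r map_mx_id. Qed.

Lemma cols_basis_ker_inj (R : realType) (p n m : nat)
    (A : 'M[R]_(p, n)) (C : 'M[R]_(n, m)) (y : 'cV[R]_m) :
  cols_basis_ker A C -> C *m y = 0 -> y = 0.
Proof.
move=> [freeC _] Cy0; apply: trmx_inj; apply: (row_free_inj freeC).
by rewrite -trmx_mul Cy0 !trmx0 mul0mx.
Qed.

Lemma cols_basis_ker_mul0 (R : realType) (p n m : nat)
    (A : 'M[R]_(p, n)) (C : 'M[R]_(n, m)) :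
  cols_basis_ker A C -> A *m C = 0.
Proof.
move=> [_ /andP[/sub_kermxP CA0 _]].
by apply: trmx_inj; rewrite trmx_mul CA0 trmx0.
Qed.

Lemma cols_basis_ker_span (R : realType) (p n m : nat)
    (A : 'M[R]_(p, n)) (C : 'M[R]_(n, m)) (x : 'cV[R]_n) :
  cols_basis_ker A C -> A *m x = 0 -> exists y : 'cV[R]_m, x = C *m y.
Proof.
move=> [_ /andP[_ kerC]] Ax0.
have /submxP[D xD] : (x^T <= C^T)%MS.
  apply: submx_trans kerC; apply/sub_kermxP.
  by rewrite -trmx_mul Ax0 trmx0.
by exists D^T; apply: trmx_inj; rewrite xD trmx_mul trmxK.
Qed.

(** If [C^T M C y = 0], then [(C y)^T M (C y) = 0], so definiteness forces [C y = 0]. With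
    [M C = B^T] this is what makes [L] invertible. *)
Lemma gram_posdef_unitmx (R : realType) (n m : nat) (M : 'M[R]_n)
    (C : 'M[R]_(n, m)) :
  sym_posdef M -> (forall y : 'cV[R]_m, C *m y = 0 -> y = 0) ->
  C^T *m M *m C \in unitmx.
Proof.
move=> [_ M_gt0] injC; apply: mulmx_col_inj_unitmx => y Ly0; apply: injC.
apply/eqP/contraT => /M_gt0.
by rewrite trmx_mul -!mulmxA (mulmxA M) (mulmxA C^T) (mulmxA C^T) Ly0 mulmx0 mxE ltxx.
Qed.

Theorem theorem2p3 (R : realType) (m n : nat) (k : R)
    (A M : 'M[R]_n) (B : 'M[R]_(m, n)) (C : 'M[R]_(n, m))
    (le_mn : (m <= n)%N)
    (A_spsd : sym_possemidef A) (dim_kerA : \rank (rkermx A) = m)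
    (M_spd : sym_posdef M)
    (B_full : row_free B)
    (C_basis : cols_basis_ker A C) (MC : M *m C = B^T)
    (K_unit : saddle (A - k ^+ 2 *: M) B \in unitmx)
    (AkM_unit : A - k ^+ 2 *: M \in unitmx) :
  let L := B *m C in
  let K := saddle (A - k ^+ 2 *: M) B in
  let T : 'M[R]_n := ulsubmx (invmx K) in
  [/\ invmx K = block_mx T (C *m invmx L) (invmx L *m C^T) (k ^+ 2 *: invmx L),
      (A - k ^+ 2 *: M) *m T = A *m Vmx A B C
    & B *m T = 0].
Proof.
move=> L K T.
have AC : A *m C = 0 by exact: cols_basis_ker_mul0 C_basis.
have injC y := cols_basis_ker_inj (y := y) C_basis.
have symM : M^T = M by apply: symmetricmx_tr; case: M_spd.
have symA : A^T = A by apply: symmetricmx_tr; case: A_spsd.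
have CA : C^T *m A = 0 by rewrite -symA -trmx_mul AC trmx0.
have CM : C^T *m M = B by rewrite -symM -trmx_mul MC trmxK.
have L_unit : L \in unitmx by rewrite /L -CM gram_posdef_unitmx.
have CB : C^T *m B^T = L by rewrite -MC mulmxA CM.
set S := A + B^T *m invmx L *m B.
have CS : C^T *m S = B by rewrite mulmxDr CA add0r !mulmxA CB mulmxV ?mul1mx.
(* Trivial kernel: [S x = 0] gives [B x = C^T S x = 0], so [S x] reduces to [A x = 0] and [x = C y].
   Then [L y = B x = 0], and [y = 0] since [L] is invertible. *)
have S_unit : S \in unitmx.
  apply: mulmx_col_inj_unitmx => x Sx0.
  have Bx0 : B *m x = 0 by rewrite -CS -mulmxA Sx0 mulmx0.
  have [|y xE] := cols_basis_ker_span (x := x) C_basis.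
    by move: Sx0; rewrite mulmxDl -!mulmxA Bx0 !mulmx0 addr0.
  by rewrite xE -[y](mulKmx L_unit) /L -mulmxA -xE Bx0 !mulmx0.
set P := 1%:M - B^T *m invmx L *m C^T.
have CP : C^T *m P = 0.
  by rewrite mulmxBr mulmx1 !mulmxA CB mulmxV // mul1mx subrr.
have AV : A *m Vmx A B C = P.
  (* Here [B V = C^T S S^-1 P = C^T P = 0], so the term [B^T L^-1 B] of [S] drops out of
     [S V = P]. *)
  have BV : B *m Vmx A B C = 0.
    by rewrite /Vmx -/L -/S -/P mulmxA -CS mulmxK.
  have : S *m Vmx A B C = P by rewrite /Vmx -/L -/S -/P mulKVmx.
  by rewrite mulmxDl -mulmxA BV mulmx0 addr0.
set F := A - k ^+ 2 *: M in K_unit AkM_unit K T *.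
have FC : F *m C = - (k ^+ 2 *: B^T).
  by rewrite mulmxBl AC -scalemxAl MC sub0r.
have CF : C^T *m F = - (k ^+ 2 *: B).
  by rewrite mulmxBr CA -scalemxAr CM sub0r.
have right_col : rsubmx (invmx K) = col_mx (C *m invmx L) (k ^+ 2 *: invmx L).
  have Kcol : K *m col_mx (C *m invmx L) (k ^+ 2 *: invmx L) = col_mx 0 1%:M.
    rewrite /K /saddle mul_block_col mul0mx addr0 !mulmxA FC -/L mulmxV //.
    by rewrite mulNmx -scalemxAl -scalemxAr addNr.
  (* Multiplying [invmx K], split into left and right halves, by [(0; I)] selects its right half. *)
  rewrite -[RHS](mulKmx K_unit) Kcol -[in RHS](hsubmxK (invmx K)).
  by rewrite mul_row_col mulmx0 add0r mulmx1.
(* The lower left block [Y] stays unknown for now; the first block column of [K K^-1 = I] will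
   determine it. *)
have KE : invmx K = block_mx T (C *m invmx L) (dlsubmx (invmx K))
                             (k ^+ 2 *: invmx L).
  move: right_col; rewrite -{1}[invmx K]submxK block_mxEh row_mxKr.
  by move=> /eq_col_mx[ur dr]; rewrite -ur -dr submxK.
have : saddle F B *m block_mx T (C *m invmx L) (dlsubmx (invmx K))
                               (k ^+ 2 *: invmx L) = 1%:M.
  by rewrite -KE mulmxV.
rewrite mulmx_block scalar_mx_block.
move=> /eq_block_mx[FTY _ BT _].
rewrite mul0mx addr0 in BT.
(* Left multiplication by [C^T] turns [F T] into [- k^2 B T = 0] and [B^T Y] into [L Y]. *)
have Y_E : dlsubmx (invmx K) = invmx L *m C^T.
  have := congr1 (mulmx C^T) FTY.
  rewrite mulmxDr !mulmxA CF CB mulmx1 mulNmx -scalemxAl BT scaler0 oppr0 add0r.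
  by move=> <-; rewrite mulKmx.
split=> //; first by rewrite KE Y_E.
by rewrite AV /P -FTY Y_E mulmxA addrK.
Qed.
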